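(* Let $(\mathcal C,\mathcal E,A,\widehat{\deg},\mathrm{rk})$ be a Harder-Narasimhan category. In the case where $A$ is non-trivial, suppose in addition that every epimorphism in $\mathcal C$ has a kernel. Then every morphism in $\mathcal C_A$ is compatible with Harder-Narasimhan filtrations; that is, if $f:\overline X\to\overline Y$ is a morphism in $\mathcal C_A$ and $(X_\lambda)_{\lambda\in\mathbb R}$, $(Y_\lambda)_{\lambda\in\mathbb R}$ are the Harder-Narasimhan filtrations of $\overline X$ and $\overline Y$, then $f:X\to Y$ is compatible with the filtrations $\big((X_\lambda)_{\lambda\in\mathbb R},(Y_\lambda)_{\lambda\in\mathbb R}\big)$.
   Context: Exact categories. An exact category $(\mathcal C,\mathcal E)$ is an exact category in the sense of Quillen with $\mathcal C$ essentially small, $\mathcal E$ being its class of distinguished short exact sequences $0\to X'\to X\to X''\to 0$. A morphism occurring as $X'\to X$ (resp. $X\to X''$) in such a sequence is an admissible monomorphism (resp. admissible epimorphism); the cokernel of an admissible monomorphism $X\to Y$ is denoted $Y/X$; $X\amalg Y$ is the direct sum. Arithmetic exact categories. An arithmetic structure $A$ on $(\mathcal C,\mathcal E)$ consists of a set $A(X)$ for every object $X$, a map $f^*:A(Y)\to A(X)$ for every admissible monomorphism $f:X\to Y$, and a map $g_*:A(X)\to A(Y)$ for every admissible epimorphism $g:X\to Y$, such that: (A1) $A(0)$ is a one-point set; (A2) $(ji)^*=i^*j^*$ for composable admissible monomorphisms $i,j$; (A3) $(qp)_*=q_*p_*$ for composable admissible epimorphisms $p,q$; (A4) $\mathrm{Id}_X^*=\mathrm{Id}_{X*}=\mathrm{Id}_{A(X)}$;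 (A5) if $f:X\to Y$ is an isomorphism then $f^*f_*=\mathrm{Id}_{A(X)}$ and $f_*f^*=\mathrm{Id}_{A(Y)}$; (A6) for every cartesian or cocartesian square with $u:X\to Y$, $v:Z\to W$ admissible monomorphisms, $p:X\to Z$, $q:Y\to W$ admissible epimorphisms and $qu=vp$, one has $v^*q_*=p_*u^*$; (A7) if $u:X\to Y$ is an admissible epimorphism, $v:Y\to Z$ an admissible monomorphism and $(h_X,h_Z)\in A(X)\times A(Z)$ satisfies $u_*(h_X)=v^*(h_Z)$, then there is $h\in A(X\amalg Z)$ with $(\mathrm{Id},vu)^*(h)=h_X$ and $\mathrm{pr}_{2*}(h)=h_Z$. Then $(\mathcal C,\mathcal E,A)$ is called an arithmetic exact category. $A$ is trivial if every $A(X)$ is a one-point set. An arithmetic object is a pair $\overline X=(X,h)$ with $h\in A(X)$, non-zero if $X\ne0$. For an admissible monomorphism $i:Y\to X$, $i^*h$ is the induced structure and $(Y,i^*h)$ is an arithmetic subobject of $(X,h)$; for an admissible epimorphism $p:X\to Z$, $p_*h$ is the quotient structure and $(Z,p_*h)$ is an arithmetic quotient of $(X,h)$. A morphism $f:X'\to X''$ of $\mathcal C$ is compatible with arithmetic structures $h'\in A(X')$, $h''\in A(X'')$ if there are an arithmetic object $(X,h)$, an admissible monomorphism $u:X'\to X$ and an admissible epimorphism $v:X\to X''$ with $f=vu$, $h'=u^*(h)$, $h''=v_*(h)$. Arithmetic objects and compatible morphisms form a category $\mathcal C_A$. Degree, rank, slope. $\mathcal E_A$ is the class of diagrams $0\to(X',h')\xrightarrow{i}(X,h)\xrightarrow{p}(X'',h'')\to0$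 with underlying sequence in $\mathcal E$, $h'=i^*h$, $h''=p_*h$. $K_0(\mathcal C,\mathcal E,A)$ is the free abelian group on isomorphism classes of $\mathcal C_A$ modulo the relations $[(X,h)]=[(X',h')]+[(X'',h'')]$ for diagrams in $\mathcal E_A$; $K_0(\mathcal C,\mathcal E)$ is the usual Grothendieck group. A degree function is a group homomorphism $\widehat{\deg}:K_0(\mathcal C,\mathcal E,A)\to\mathbb R$; a rank function is a group homomorphism $\mathrm{rk}:K_0(\mathcal C,\mathcal E)\to\mathbb Z$ with $\mathrm{rk}([X])>0$ for $X\neq0$. For a non-zero arithmetic object, $\widehat\mu(X,h)=\widehat{\deg}(X,h)/\mathrm{rk}(X)$; it is semistable if $\widehat\mu(X',h')\le\widehat\mu(X,h)$ for every non-zero arithmetic subobject $(X',h')$. Harder-Narasimhan category. $(\mathcal C,\mathcal E,A,\widehat{\deg},\mathrm{rk})$ is a Harder-Narasimhan category if: (HN1) every non-zero arithmetic object $(X,h)$ has a (non-zero) arithmetic subobject $(X_{\mathrm{des}},h_{\mathrm{des}})$ whose slope equals $\sup\{\widehat\mu(X',h'):(X',h')\text{ a non-zero arithmetic subobject of }(X,h)\}$, and for every non-zero arithmetic subobject $(X_0,h_0)$ of $(X,h)$ with $\widehat\mu(X_0,h_0)=\widehat\mu(X_{\mathrm{des}},h_{\mathrm{des}})$ there is an admissible monomorphism $f:X_0\to X_{\mathrm{des}}$, commuting with the inclusions into $X$, such that $f^*(h_{\mathrm{des}})=h_0$; (HN2) if $(X_1,h_1)$, $(X_2,h_2)$ are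 semistable with $\widehat\mu(X_1,h_1)>\widehat\mu(X_2,h_2)$, there is no non-zero morphism $X_1\to X_2$ compatible with arithmetic structures. Harder-Narasimhan sequence. Every non-zero arithmetic object $\overline X=(X,h)$ of a Harder-Narasimhan category has a sequence of admissible monomorphisms $0=X_0^{\mathrm{HN}}\to X_1^{\mathrm{HN}}\to\cdots\to X_n^{\mathrm{HN}}=X$, unique up to unique isomorphism, such that (with $X_i^{\mathrm{HN}}$ carrying the structure induced from $h$ and the quotients $\overline{X_i^{\mathrm{HN}}/X_{i-1}^{\mathrm{HN}}}$ the quotient structures) all $\overline{X_i^{\mathrm{HN}}/X_{i-1}^{\mathrm{HN}}}$ are semistable, with slopes strictly decreasing in $i$. Filtrations. Let $\mathbb R^*=\mathbb R\cup\{-\infty\}$, viewed as a category with exactly one morphism $i\to j$ if $i\ge j$ and none otherwise. An $\mathbb R$-filtration of an object $X$ of $\mathcal C$ is a functor $\mathcal F:\mathbb R^*\to\mathcal C$ with $\mathcal F(-\infty)=X$ sending all morphisms to monomorphisms. If $\mathcal F$, $\mathcal G$ are filtrations of $X$, $Y$, a morphism $f:X\to Y$ is compatible with $(\mathcal F,\mathcal G)$ if there is a natural transformation $\mathcal F\to\mathcal G$ whose component at $-\infty$ is $f$. Harder-Narasimhan filtration. For $\overline X$ non-zero and $\lambda\in\mathbb R$, put $i_{\overline X}(\lambda)=\max\{1\le i\le n:\widehat\mu(\overline{X_i^{\mathrm{HN}}/X_{i-1}^{\mathrm{HN}}})\ge\lambda\}$ (with $\max\emptyset=0$) and $X_\lambda=X^{\mathrm{HN}}_{i_{\overline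 X}(\lambda)}$. The $\mathbb R$-filtration $(X_\lambda)_{\lambda\in\mathbb R}$ of $X$ (transition morphisms being those of the Harder-Narasimhan sequence) is the Harder-Narasimhan filtration of $\overline X$. For the zero object, all $X_\lambda$ are $0$. *)

(* Defs.v *)
From HB Require Import structures.
From mathcomp Require Import all_boot all_order all_algebra.
From mathcomp Require Import boolp classical_sets reals ereal.
From mathcomp Require Import freeg.
Import Order.TTheory GRing.Theory Num.Theory.

Set Implicit Arguments.
Unset Strict Implicit.
Unset Printing Implicit Defensive.

Local Open Scope ring_scope.

(* Objects and morphisms live in [Type], so a category is small relative to
   the universe of its objects. *)
Record category := Category {
  obj :> Type;
  mor : obj -> obj -> Type;
  id_mor : forall X, mor X X;
  compm : forall X Y Z, mor Y Z -> mor X Y -> mor X Z;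
  compm_idl : forall X Y (f : mor X Y), compm (id_mor Y) f = f;
  compm_idr : forall X Y (f : mor X Y), compm f (id_mor X) = f;
  compmA : forall X Y Z W (h : mor Z W) (g : mor Y Z) (f : mor X Y),
    compm h (compm g f) = compm (compm h g) f }.

Arguments id_mor {c} X.
Arguments compm {c X Y Z} g f.

Notation "g \oc f" := (compm g f) (at level 40, left associativity).

Section CategoryNotions.
Variable C : category.
Implicit Types X Y Z W : C.

Definition is_iso X Y (f : mor X Y) : Prop :=
  exists g : mor Y X, g \oc f = id_mor X /\ f \oc g = id_mor Y.

Definition is_mono X Y (f : mor X Y) : Prop :=
  forall Z (a b : mor Z X), f \oc a = f \oc b -> a = b.

Definition is_epi X Y (f : mor X Y) : Prop :=
  forall Z (a b : mor Y Z), a \oc f = b \oc f -> a = b.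

Definition is_zero X : Prop :=
  (forall Y, exists! f : mor X Y, True) /\ (forall Y, exists! f : mor Y X, True).

(* The square
       X --u--> Y
       |p       |q
       v        v
       Z --v--> W   *)
Definition is_pullback X Y Z W
    (u : mor X Y) (p : mor X Z) (q : mor Y W) (v : mor Z W) : Prop :=
  q \oc u = v \oc p /\
  forall T (a : mor T Y) (b : mor T Z), q \oc a = v \oc b ->
    exists! t : mor T X, u \oc t = a /\ p \oc t = b.

Definition is_pushout X Y Z W
    (u : mor X Y) (p : mor X Z) (q : mor Y W) (v : mor Z W) : Prop :=
  q \oc u = v \oc p /\
  forall T (a : mor Y T) (b : mor Z T), a \oc u = b \oc p ->
    exists! t : mor W T, t \oc q = a /\ t \oc v = b.

Definition cast_hom X X' Y Y' (eX : X = X') (eY : Y = Y') (f : mor X Y) :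
    mor X' Y' :=
  match eX in _ = X1, eY in _ = Y1 return mor X1 Y1 with
  | erefl, erefl => f
  end.

Lemma is_mono_id X : is_mono (id_mor X).
Proof. by move=> Z a b; rewrite !compm_idl. Qed.

Lemma is_mono_comp X Y Z (g : mor Y Z) (f : mor X Y) :
  is_mono g -> is_mono f -> is_mono (g \oc f).
Proof. by move=> mg mf T a b; rewrite -!compmA => /mg /mf. Qed.

End CategoryNotions.

Record functor (C D : category) := Functor {
  fobj :> C -> D;
  functor_map : forall X Y : C, mor X Y -> mor (fobj X) (fobj Y);
  functor_map_id : forall X, functor_map (id_mor X) = id_mor (fobj X);
  functor_map_comp : forall (X Y Z : C) (g : mor Y Z) (f : mor X Y),
    functor_map (g \oc f) = functor_map g \oc functor_map f }.

Record nat_trans (C D : category) (F G : functor C D) := NatTrans {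
  component :> forall X : C, mor (F X) (G X);
  naturality : forall (X Y : C) (f : mor X Y),
    component Y \oc functor_map F f = functor_map G f \oc component X }.

Record zmod_category := ZmodCategory {
  zmod_cat :> category;
  mor_zmod : forall X Y : zmod_cat, GRing.Zmodule (mor X Y) }.

HB.instance Definition _ (C : zmod_category) (X Y : C) := @mor_zmod C X Y.

Record additive_category := AdditiveCategory {
  additive_cat :> zmod_category;
  compmDl : forall (X Y Z : additive_cat) (g g' : mor Y Z) (f : mor X Y),
    (g + g') \oc f = g \oc f + g' \oc f;
  compmDr : forall (X Y Z : additive_cat) (g : mor Y Z) (f f' : mor X Y),
    g \oc (f + f') = g \oc f + g \oc f';
  zero_obj : additive_cat;
  zero_objP : is_zero zero_obj;
  biprod : additive_cat -> additive_cat -> additive_cat;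
  in1 : forall X Y, mor X (biprod X Y);
  in2 : forall X Y, mor Y (biprod X Y);
  pr1 : forall X Y, mor (biprod X Y) X;
  pr2 : forall X Y, mor (biprod X Y) Y;
  pr1_in1 : forall X Y, pr1 X Y \oc in1 X Y = id_mor X;
  pr2_in2 : forall X Y, pr2 X Y \oc in2 X Y = id_mor Y;
  pr1_in2 : forall X Y, pr1 X Y \oc in2 X Y = 0;
  pr2_in1 : forall X Y, pr2 X Y \oc in1 X Y = 0;
  in_pr : forall X Y,
    in1 X Y \oc pr1 X Y + in2 X Y \oc pr2 X Y = id_mor (biprod X Y) }.

Section AdditiveNotions.
Variable C : additive_category.
Implicit Types X Y Z K : C.

Lemma comp0m X Y Z (f : mor X Y) : (0 : mor Y Z) \oc f = 0.
Proof.
by apply: (addrI (0 \oc f)); rewrite -compmDl !addr0.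
Qed.

Lemma compm0 X Y Z (g : mor Y Z) : g \oc (0 : mor X Y) = 0.
Proof.
by apply: (addrI (g \oc 0)); rewrite -compmDr !addr0.
Qed.

Lemma compmNl X Y Z (g : mor Y Z) (f : mor X Y) : (- g) \oc f = - (g \oc f).
Proof. by apply: (addrI (g \oc f)); rewrite -compmDl !subrr comp0m. Qed.

Lemma compmNr X Y Z (g : mor Y Z) (f : mor X Y) : g \oc (- f) = - (g \oc f).
Proof. by apply: (addrI (g \oc f)); rewrite -compmDr !subrr compm0. Qed.

Definition is_kernel X Y K (k : mor K X) (f : mor X Y) : Prop :=
  f \oc k = 0 /\
  forall T (a : mor T X), f \oc a = 0 -> exists! t : mor T K, k \oc t = a.

Definition is_cokernel X Y K (c : mor Y K) (f : mor X Y) : Prop :=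
  c \oc f = 0 /\
  forall T (a : mor Y T), a \oc f = 0 -> exists! t : mor K T, t \oc c = a.

Definition pairm X Y Z (f : mor X Y) (g : mor X Z) : mor X (biprod Y Z) :=
  in1 Y Z \oc f + in2 Y Z \oc g.

End AdditiveNotions.

Definition seq_class (C : category) :=
  forall X' X X'' : C, mor X' X -> mor X X'' -> Prop.

Definition adm_mono_for (C : category) (E : seq_class C) (X' X : C)
  (i : mor X' X) : Prop := exists (X'' : C) (p : mor X X''), E _ _ _ i p.

Definition adm_epi_for (C : category) (E : seq_class C) (X X'' : C)
  (p : mor X X'') : Prop := exists (X' : C) (i : mor X' X), E _ _ _ i p.

(* Quillen's axioms, including the "obscure" ones [Q_obscure_epi] and
   [Q_obscure_mono] of his original definition. *)
Record quillen_exact (C : additive_category) (E : seq_class C) : Prop := {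
  Q_kernel : forall (X' X X'' : C) (i : mor X' X) (p : mor X X''),
    E _ _ _ i p -> is_kernel i p /\ is_cokernel p i;
  Q_split : forall X Y : C, E _ _ _ (in1 X Y) (pr2 X Y);
  Q_iso : forall (X' X X'' Y' Y Y'' : C)
      (i : mor X' X) (p : mor X X'') (j : mor Y' Y) (q : mor Y Y'')
      (a' : mor X' Y') (a : mor X Y) (a'' : mor X'' Y''),
    E _ _ _ i p -> is_iso a' -> is_iso a -> is_iso a'' ->
    j \oc a' = a \oc i -> q \oc a = a'' \oc p -> E _ _ _ j q;
  Q_mono_comp : forall (X Y Z : C) (g : mor Y Z) (f : mor X Y),
    adm_mono_for E g -> adm_mono_for E f -> adm_mono_for E (g \oc f);
  Q_epi_comp : forall (X Y Z : C) (g : mor Y Z) (f : mor X Y),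
    adm_epi_for E g -> adm_epi_for E f -> adm_epi_for E (g \oc f);
  Q_pushout_ex : forall (X Y Z : C) (u : mor X Y) (p : mor X Z),
    adm_mono_for E u ->
    exists (W : C) (q : mor Y W) (v : mor Z W), is_pushout u p q v;
  Q_pushout : forall (X Y Z W : C)
      (u : mor X Y) (p : mor X Z) (q : mor Y W) (v : mor Z W),
    adm_mono_for E u -> is_pushout u p q v -> adm_mono_for E v;
  Q_pullback_ex : forall (Y Z W : C) (q : mor Y W) (v : mor Z W),
    adm_epi_for E q ->
    exists (X : C) (u : mor X Y) (p : mor X Z), is_pullback u p q v;
  Q_pullback : forall (X Y Z W : C)
      (u : mor X Y) (p : mor X Z) (q : mor Y W) (v : mor Z W),
    adm_epi_for E q -> is_pullback u p q v -> adm_epi_for E p;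
  Q_obscure_epi : forall (X Y Z : C) (f : mor X Y) (g : mor Z X),
    (exists (K : C) (k : mor K X), is_kernel k f) ->
    adm_epi_for E (f \oc g) -> adm_epi_for E f;
  Q_obscure_mono : forall (X Y Z : C) (f : mor X Y) (g : mor Y Z),
    (exists (K : C) (c : mor Y K), is_cokernel c f) ->
    adm_mono_for E (g \oc f) -> adm_mono_for E f }.

Record exact_category := ExactCategory {
  exact_cat :> additive_category;
  ses : seq_class exact_cat;
  exactP : quillen_exact ses }.

Arguments ses {e} [X' X X''] i p.

Definition adm_mono (C : exact_category) (X Y : C) (f : mor X Y) : Prop :=
  adm_mono_for (@ses C) f.
Definition adm_epi (C : exact_category) (X Y : C) (f : mor X Y) : Prop :=
  adm_epi_for (@ses C) f.

Section ExactFacts.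
Variable C : exact_category.
Implicit Types X Y Z : C.

Lemma is_iso_id X : is_iso (id_mor X).
Proof. by exists (id_mor X); rewrite compm_idl. Qed.

Lemma adm_mono_is_mono X Y (f : mor X Y) : adm_mono f -> is_mono f.
Proof.
move=> [Z [p Ep]] T a b eab.
have [[pf0 univ] _] := Q_kernel (exactP C) Ep.
have [|t [_ tu]] := univ T (f \oc a); first by rewrite compmA pf0 comp0m.
by rewrite -(tu a erefl) (tu b).
Qed.

Lemma adm_mono_comp X Y Z (g : mor Y Z) (f : mor X Y) :
  adm_mono g -> adm_mono f -> adm_mono (g \oc f).
Proof. exact: Q_mono_comp (exactP C) _ _ _ _ _. Qed.

Lemma adm_epi_pr2 X Y : adm_epi (pr2 X Y).
Proof. by exists X, (in1 X Y); apply: Q_split (exactP C) _ _. Qed.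

Lemma zero_mor_eq X Y (a b : mor X Y) : is_zero X -> a = b.
Proof. by case=> /(_ Y) [f [_ fu]] _; rewrite -(fu a) // -(fu b). Qed.

Lemma zero_mor_eqr X Y (a b : mor X Y) : is_zero Y -> a = b.
Proof. by case=> _ /(_ X) [f [_ fu]]; rewrite -(fu a) // -(fu b). Qed.

Lemma adm_mono_iso X Y (f : mor X Y) : is_iso f -> adm_mono f.
Proof.
case=> g [gf fg]; pose O := zero_obj C.
have zO : is_zero O := zero_objP C.
exists O, (0 : mor Y O).
apply: (Q_iso (exactP C) (a' := id_mor X) (a := f \oc pr1 X O) (a'' := id_mor O)
          (Q_split (exactP C) X O)).
- exact: is_iso_id.
- exists (in1 X O \oc g); split.
    rewrite -compmA (compmA g) gf compm_idl.
    rewrite -(in_pr X O) -[LHS]addr0; congr (_ + _).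
    by rewrite (zero_mor_eqr (pr2 X O) 0 zO) compm0.
  by rewrite compmA -(compmA f) pr1_in1 compm_idr fg.
- exact: is_iso_id.
- by rewrite compm_idr -compmA pr1_in1 compm_idr.
- exact: zero_mor_eqr.
Qed.

(* [(Id, g) : X -> X (+) Z] is [in1] followed by a shear automorphism. *)
Lemma adm_mono_graph X Z (g : mor X Z) : adm_mono (pairm (id_mor X) g).
Proof.
pose sh (k : mor X Z) := id_mor (biprod X Z) + in2 X Z \oc (k \oc pr1 X Z).
have shE k k' : sh k \oc sh k' = sh (k + k').
  rewrite /sh !compmDl !compmDr !compm_idl !compm_idr -!compmA.
  rewrite (compmA (pr1 X Z)) pr1_in2 comp0m !compm0 addr0.
  by rewrite addrAC -addrA.
have sh0 : sh 0 = id_mor _ by rewrite /sh comp0m compm0 addr0.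
have isosh k : is_iso (sh k).
  by exists (sh (- k)); rewrite !shE addNr subrr sh0.
have -> : pairm (id_mor X) g = sh g \oc in1 X Z.
  rewrite /pairm /sh compmDl compm_idl compm_idr -!compmA.
  by rewrite pr1_in1 compm_idr.
apply: adm_mono_comp; first exact: adm_mono_iso.
by exists Z, (pr2 X Z); apply: Q_split (exactP C) _ _.
Qed.

End ExactFacts.

(* The free abelian group on [T] modulo the subgroup generated by [x - y] for
   [iso x y] and [x - x' - x''] for [exact x' x x''].  Killing the first kind
   of generators amounts to starting from isomorphism classes.  [{classic T}]
   is [T] with the choice structure that [{freeg _}] asks for. *)
Section Grothendieck.
Variables (T : Type) (iso : T -> T -> Prop) (exact : T -> T -> T -> Prop).

Local Notation free := {freeg {classic T} / int}.

Definition fgen (x : T) : free := << (x : {classic T}) >>.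

Inductive relation_span : free -> Prop :=
| span0 : relation_span 0
| spanB a b : relation_span a -> relation_span b -> relation_span (a - b)
| span_iso x y : iso x y -> relation_span (fgen x - fgen y)
| span_exact x' x x'' : exact x' x x'' ->
    relation_span (fgen x - (fgen x' + fgen x'')).

Definition relation_subgroup : {pred free} := fun a => `[< relation_span a >].

Lemma relation_subgroup_zmod : zmod_closed relation_subgroup.
Proof.
split; first by apply/asboolP; exact: span0.
by move=> a b /asboolP sa /asboolP sb; apply/asboolP; exact: spanB.
Qed.

HB.instance Definition _ :=
  GRing.isZmodClosed.Build free relation_subgroup relation_subgroup_zmod.

Definition grothendieck := Quotient.quot relation_subgroup.

HB.instance Definition _ := GRing.Zmodule.on grothendieck.

Definition k_class (x : T) : grothendieck :=
  \pi_(Quotient.quot relation_subgroup)%qT (fgen x).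

Lemma k_class_iso x y : iso x y -> k_class x = k_class y.
Proof.
move=> xy; apply/eqP; rewrite /k_class -Quotient.idealrBE.
by apply/asboolP; exact: span_iso.
Qed.

Lemma k_class_exact x' x x'' :
  exact x' x x'' -> k_class x = k_class x' + k_class x''.
Proof.
move=> ex; rewrite /k_class -raddfD; apply/eqP.
by rewrite -Quotient.idealrBE; apply/asboolP; exact: span_exact.
Qed.

End Grothendieck.

Definition one_point (T : Type) : Prop := exists x : T, forall y : T, y = x.

(* [pull hf] is f^* and [push hg] is g_*, where [hf] and [hg] witness that f is
   an admissible monomorphism and g an admissible epimorphism.  Each axiom
   quantifies over all witnesses. *)
Record arith_structure (C : exact_category) := ArithStructure {
  astr :> C -> Type;
  pull : forall (X Y : C) (f : mor X Y), adm_mono f -> astr Y -> astr X;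
  push : forall (X Y : C) (g : mor X Y), adm_epi g -> astr X -> astr Y;
  A1 : forall X : C, is_zero X -> one_point (astr X);
  A2 : forall (X Y Z : C) (i : mor X Y) (j : mor Y Z)
      (hi : adm_mono i) (hj : adm_mono j) (hji : adm_mono (j \oc i)) h,
    pull hji h = pull hi (pull hj h);
  A3 : forall (X Y Z : C) (p : mor X Y) (q : mor Y Z)
      (hp : adm_epi p) (hq : adm_epi q) (hqp : adm_epi (q \oc p)) h,
    push hqp h = push hq (push hp h);
  A4_pull : forall (X : C) (hid : adm_mono (id_mor X)) h, pull hid h = h;
  A4_push : forall (X : C) (hid : adm_epi (id_mor X)) h, push hid h = h;
  A5_dom : forall (X Y : C) (f : mor X Y) (m : adm_mono f) (e : adm_epi f) h,
    is_iso f -> pull m (push e h) = h;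
  A5_cod : forall (X Y : C) (f : mor X Y) (m : adm_mono f) (e : adm_epi f) h,
    is_iso f -> push e (pull m h) = h;
  A6 : forall (X Y Z W : C)
      (u : mor X Y) (p : mor X Z) (q : mor Y W) (v : mor Z W)
      (hu : adm_mono u) (hp : adm_epi p) (hq : adm_epi q) (hv : adm_mono v) h,
    is_pullback u p q v \/ is_pushout u p q v ->
    pull hv (push hq h) = push hp (pull hu h);
  A7 : forall (X Y Z : C) (u : mor X Y) (v : mor Y Z)
      (hu : adm_epi u) (hv : adm_mono v) (hX : astr X) (hZ : astr Z),
    push hu hX = pull hv hZ ->
    exists h : astr (biprod X Z),
      pull (adm_mono_graph (v \oc u)) h = hX /\ push (adm_epi_pr2 X Z) h = hZ }.

Arguments pull {C a X Y f} hf h : rename.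
Arguments push {C a X Y g} hg h : rename.

Definition trivial_arith (C : exact_category) (A : arith_structure C) : Prop :=
  forall X : C, one_point (A X).

Record arith_object (C : exact_category) (A : arith_structure C) := ArithObject {
  under :> C;
  str : A under }.

Section ArithObjects.
Variables (C : exact_category) (A : arith_structure C).
Implicit Types X Y Z : arith_object A.

Definition asub X (Y : C) (i : mor Y X) (hi : adm_mono i) : arith_object A :=
  ArithObject (pull hi (str X)).

Definition aquot X (Y : C) (p : mor X Y) (hp : adm_epi p) : arith_object A :=
  ArithObject (push hp (str X)).

(* [f : X -> Y] is a morphism of the category C_A. *)
Definition compatible X Y (f : mor X Y) : Prop :=
  exists (Z : arith_object A) (u : mor X Z) (v : mor Z Y)
         (hu : adm_mono u) (hv : adm_epi v),
    [/\ f = v \oc u, str X = pull hu (str Z) & str Y = push hv (str Z)].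

Definition arith_iso X Y : Prop :=
  exists (f : mor X Y) (g : mor Y X),
    [/\ compatible f, compatible g, g \oc f = id_mor _ & f \oc g = id_mor _].

Definition arith_ses X' X X'' : Prop :=
  exists (i : mor X' X) (p : mor X X'') (hi : adm_mono i) (hp : adm_epi p),
    [/\ ses i p, str X' = pull hi (str X) & str X'' = push hp (str X)].

Definition K0_arith := grothendieck arith_iso arith_ses.

End ArithObjects.

Section K0.
Variable C : exact_category.

Definition isomorphic (X Y : C) : Prop := exists f : mor X Y, is_iso f.

Definition in_ses (X' X X'' : C) : Prop :=
  exists (i : mor X' X) (p : mor X X''), ses i p.

Definition K0 := grothendieck isomorphic in_ses.

End K0.

Definition degree_function (R : realType) (C : exact_category)
  (A : arith_structure C) := {additive K0_arith A -> R}.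

Record rank_function (C : exact_category) := RankFunction {
  rank_add : {additive K0 C -> int};
  rank_gt0 : forall X : C, ~ is_zero X -> 0 < rank_add (k_class _ _ X) }.

Section Slopes.
Variables (R : realType) (C : exact_category) (A : arith_structure C).
Variables (deg : degree_function R A) (rk : rank_function C).
Implicit Types X Y : arith_object A.

Definition adeg X : R := deg (k_class _ _ X).
Definition rank (X : C) : int := rank_add rk (k_class _ _ X).
Definition slope X : R := adeg X / (rank X)%:~R.

Definition semistable X : Prop :=
  ~ is_zero (under X) /\
  forall (Y : C) (i : mor Y X) (hi : adm_mono i),
    ~ is_zero Y -> slope (asub hi) <= slope X.

Definition sub_slopes X : set (\bar R) :=
  [set s | exists (Y : C) (i : mor Y X) (hi : adm_mono i),
     ~ is_zero Y /\ s = (slope (asub hi))%:E]%classic.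

Definition HN1 : Prop :=
  forall X, ~ is_zero (under X) ->
  exists (D : C) (i : mor D X) (hi : adm_mono i),
    [/\ ~ is_zero D,
        (slope (asub hi))%:E = ereal_sup (sub_slopes X) &
        forall (X0 : C) (i0 : mor X0 X) (hi0 : adm_mono i0),
          ~ is_zero X0 -> slope (asub hi0) = slope (asub hi) ->
          exists (f : mor X0 D) (hf : adm_mono f),
            i \oc f = i0 /\ pull hf (str (asub hi)) = str (asub hi0)].

Definition HN2 : Prop :=
  forall X1 X2, semistable X1 -> semistable X2 -> slope X2 < slope X1 ->
  forall f : mor X1 X2, compatible f -> f = 0.

Definition HN_category : Prop := HN1 /\ HN2.

End Slopes.

(* A sequence of admissible monomorphisms X_0 -> ... -> X_n = X with X_0 = 0,
   presented as a functor on the poset {0, ..., n}, the identification of X_n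
   with X being an isomorphism [seq_top].  The cokernels X_i / X_(i-1) are part
   of the data; as ordinals start at 0, [seq_quot i] is X_(i+1) / X_i. *)
Record mono_sequence (C : exact_category) (X : C) := MonoSequence {
  seq_len : nat;
  seq_obj : 'I_seq_len.+1 -> C;
  seq_map : forall i j : 'I_seq_len.+1,
    (i <= j)%N -> mor (seq_obj i) (seq_obj j);
  seq_map_id : forall (i : 'I_seq_len.+1) (ii : (i <= i)%N),
    seq_map ii = id_mor (seq_obj i);
  seq_map_comp : forall (i j k : 'I_seq_len.+1)
      (ij : (i <= j)%N) (jk : (j <= k)%N) (ik : (i <= k)%N),
    seq_map ik = seq_map jk \oc seq_map ij;
  seq_map_adm : forall (i j : 'I_seq_len.+1) (ij : (i <= j)%N),
    adm_mono (seq_map ij);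
  seq_bot : is_zero (seq_obj ord0);
  seq_top : mor (seq_obj ord_max) X;
  seq_top_iso : is_iso seq_top;
  seq_quot : 'I_seq_len -> C;
  seq_proj : forall i : 'I_seq_len,
    mor (seq_obj (fintype.lift ord0 i)) (seq_quot i);
  seq_ses : forall (i : 'I_seq_len)
      (ii : (widen_ord (leqnSn seq_len) i <= fintype.lift ord0 i)%N),
    ses (seq_map ii) (seq_proj i) }.

Arguments seq_map {C X} m [i j] ij : rename.
Arguments seq_quot {C X} m i : rename.
Arguments seq_proj {C X} m i : rename.

Section MonoSequence.
Variables (C : exact_category) (X : C) (s : mono_sequence X).

Definition seq_incl (i : 'I_(seq_len s).+1) : mor (seq_obj i) X :=
  seq_top s \oc seq_map s (leq_ord i : (i <= ord_max)%N).

Lemma seq_incl_adm i : adm_mono (seq_incl i).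
Proof.
apply: adm_mono_comp; last exact: seq_map_adm.
exact/adm_mono_iso/seq_top_iso.
Qed.

Lemma seq_incl_map (i j : 'I_(seq_len s).+1) (ij : (i <= j)%N) :
  seq_incl i = seq_incl j \oc seq_map s ij.
Proof.
rewrite /seq_incl -compmA; congr (_ \oc _); exact: seq_map_comp.
Qed.

Lemma seq_proj_adm i : adm_epi (seq_proj s i).
Proof.
have ii : (widen_ord (leqnSn (seq_len s)) i <= fintype.lift ord0 i)%N.
  by rewrite /= /bump leq0n add1n.
by exists _, (seq_map s ii); apply: seq_ses.
Qed.

End MonoSequence.

Section HNSequence.
Variables (R : realType) (C : exact_category) (A : arith_structure C).
Variables (deg : degree_function R A) (rk : rank_function C).
Variable X : arith_object A.

Definition seq_term (s : mono_sequence (under X)) (i : 'I_(seq_len s).+1) :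
  arith_object A := asub (seq_incl_adm i).

Definition seq_gr (s : mono_sequence (under X)) (i : 'I_(seq_len s)) :
  arith_object A := aquot (X := seq_term (fintype.lift ord0 i)) (seq_proj_adm i).

(* If X is zero, the Harder-Narasimhan sequences of X are those of length 0:
   a semistable subquotient is non-zero. *)
Record HN_sequence := HNSequence {
  hn_seq :> mono_sequence (under X);
  hn_semistable : forall i, semistable deg rk (@seq_gr hn_seq i);
  hn_decreasing : forall i j : 'I_(seq_len hn_seq), (i < j)%N ->
    slope deg rk (seq_gr j) < slope deg rk (seq_gr i) }.

End HNSequence.

(* [None] stands for -oo. *)
Definition Rstar_le (R : realType) (a b : option R) : bool :=
  match a, b with
  | None, _ => true
  | Some _, None => false
  | Some x, Some y => x <= y
  end.

Lemma Rstar_refl (R : realType) (a : option R) : Rstar_le a a.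
Proof. by case: a => //= x. Qed.

Lemma Rstar_trans (R : realType) (a b c : option R) :
  Rstar_le c b -> Rstar_le b a -> Rstar_le c a.
Proof. by case: a b c => [x|] [y|] [z|] //=; exact: le_trans. Qed.

Program Definition Rstar (R : realType) : category := {|
  obj := option R;
  mor i j := is_true (Rstar_le j i);
  id_mor i := Rstar_refl i;
  compm i j k jk ij := Rstar_trans jk ij |}.
Next Obligation. by move=> *; exact: bool_irrelevance. Qed.
Next Obligation. by move=> *; exact: bool_irrelevance. Qed.
Next Obligation. by move=> *; exact: bool_irrelevance. Qed.

Record filtration (R : realType) (C : category) (X : C) := Filtration {
  fil_functor :> functor (Rstar R) C;
  fil_ninfty : fil_functor None = X;
  fil_mono : forall (i j : Rstar R) (ij : mor i j),
    is_mono (functor_map fil_functor ij) }.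

Definition filtration_compatible (R : realType) (C : category) (X Y : C)
    (F : filtration R X) (G : filtration R Y) (f : mor X Y) : Prop :=
  exists eta : nat_trans F G,
    cast_hom (fil_ninfty F) (fil_ninfty G) (eta None) = f.

Section HNFiltration.
Variables (R : realType) (C : exact_category) (A : arith_structure C).
Variables (deg : degree_function R A) (rk : rank_function C).
Variables (X : arith_object A) (s : HN_sequence deg rk X).

(* The shift [i.+1] turns the 0-based index of [seq_gr] into the 1-based one. *)
Definition hn_index_nat (lam : R) : nat :=
  \max_(i < seq_len s | lam <= slope deg rk (seq_gr i)) i.+1.

Lemma hn_index_lt lam : (hn_index_nat lam < (seq_len s).+1)%N.
Proof. by rewrite ltnS; apply/bigmax_leqP => i _. Qed.

Definition hn_index (lam : R) : 'I_(seq_len s).+1 := Ordinal (hn_index_lt lam).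

Lemma hn_index_le (a b : R) : b <= a -> (hn_index a <= hn_index b)%N.
Proof.
move=> ba; apply/bigmax_leqP => i ai.
apply: (leq_bigmax_cond (F := fun i : 'I_(seq_len s) => i.+1) i).
exact: le_trans ai.
Qed.

Definition hn_fobj (a : Rstar R) : C :=
  match a with
  | None => X
  | Some lam => seq_obj (hn_index lam)
  end.

Definition hn_fmap (a b : Rstar R) : mor a b -> mor (hn_fobj a) (hn_fobj b) :=
  match a, b return is_true (Rstar_le b a) -> mor (hn_fobj a) (hn_fobj b) with
  | Some x, Some y => fun yx => seq_map s (hn_index_le yx)
  | Some x, None => fun _ => seq_incl (hn_index x)
  | None, None => fun _ => id_mor (under X)
  | None, Some y => fun absurd => False_rect _ (notF absurd)
  end.

Lemma hn_fmap_id a : hn_fmap (id_mor a) = id_mor (hn_fobj a).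
Proof. by case: a => [x|] //=; exact: seq_map_id. Qed.

Lemma hn_fmap_comp (a b c : Rstar R) (g : mor b c) (f : mor a b) :
  hn_fmap (g \oc f) = hn_fmap g \oc hn_fmap f.
Proof.
case: a b c g f => [x|] [y|] [z|] //= g f.
- exact: seq_map_comp.
- exact: seq_incl_map.
- by rewrite compm_idl.
- by rewrite compm_idl.
Qed.

Lemma hn_fmap_mono (a b : Rstar R) (f : mor a b) : is_mono (hn_fmap f).
Proof.
case: a b f => [x|] [y|] //= f.
- exact/adm_mono_is_mono/seq_map_adm.
- exact/adm_mono_is_mono/seq_incl_adm.
- exact: is_mono_id.
Qed.

Definition HN_filtration : filtration R (under X) :=
  @Filtration R C (under X) (Functor hn_fmap_id hn_fmap_comp)
    erefl hn_fmap_mono.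

End HNFiltration.

(* Main.v *)
(** By dévissage every compatible morphism [X_λ -> Y] lands in [Y_λ]: a
    compatible morphism from [X_i] to a semistable quotient [Y_j / Y_(j-1)] of
    slope [< λ] is killed by (HN2) one subquotient of [X_i] at a time.  For this,
    compatibility must survive two factorizations: through a quotient of the
    source on which the morphism is defined, and through a subobject of the target
    containing the image.  Either way, the existence of kernels of epimorphisms
    and Quillen's obscure axiom make the new factor admissible; when [A] is
    trivial every morphism is compatible, through its graph. *)

Require Import Defs.
From mathcomp Require Import all_boot all_order all_algebra.
From mathcomp Require Import boolp reals.
Import Order.TTheory GRing.Theory Num.Theory.

Set Implicit Arguments.
Unset Strict Implicit.
Unset Printing Implicit Defensive.

Local Open Scope ring_scope.

(** * Cancellation and squares in exact categories *)

Section ExactCategories.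
Variable C : exact_category.
Implicit Types X Y Z T : C.

Lemma ses_comp0 X Y Z (i : mor X Y) (p : mor Y Z) : ses i p -> p \oc i = 0.
Proof. by move=> /(Q_kernel (exactP C)) [[]]. Qed.

Lemma ses_factor_kernel X Y Z (i : mor X Y) (p : mor Y Z) T (a : mor T Y) :
  ses i p -> p \oc a = 0 -> exists t : mor T X, i \oc t = a.
Proof.
by move=> /(Q_kernel (exactP C)) [[_ univ] _] /univ [t [ta _]]; exists t.
Qed.

Lemma ses_factor_cokernel X Y Z (i : mor X Y) (p : mor Y Z) T (a : mor Y T) :
  ses i p -> a \oc i = 0 -> exists t : mor Z T, t \oc p = a.
Proof.
by move=> /(Q_kernel (exactP C)) [_ [_ univ]] /univ [t [ta _]]; exists t.
Qed.

Lemma ses_mono X Y Z (i : mor X Y) (p : mor Y Z) : ses i p -> is_mono i.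
Proof. by move=> E; apply: adm_mono_is_mono; exists Z, p. Qed.

Lemma ses_epi X Y Z (i : mor X Y) (p : mor Y Z) : ses i p -> is_epi p.
Proof.
move=> E T a b eab; have [_ [pi0 univ]] := Q_kernel (exactP C) E.
have [|t [_ tu]] := univ T (a \oc p); first by rewrite -compmA pi0 compm0.
by rewrite -(tu a erefl) (tu b).
Qed.

Lemma adm_epi_comp X Y Z (g : mor Y Z) (f : mor X Y) :
  adm_epi g -> adm_epi f -> adm_epi (g \oc f).
Proof. exact: Q_epi_comp (exactP C) _ _ _ _ _. Qed.

Definition epis_have_kernels : Prop :=
  forall X Y (f : mor X Y), is_epi f -> exists K (k : mor K X), is_kernel k f.

(** [g] inherits right cancellability from [g \oc f], so it has a kernel and Quillen's obscure axiom
    applies. *)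
Lemma adm_epi_cancel X Y Z (g : mor Y Z) (f : mor X Y) :
  epis_have_kernels -> adm_epi (g \oc f) -> adm_epi g.
Proof.
move=> hker agf; apply: (Q_obscure_epi (exactP C) _ agf); apply: hker.
have [N [n /ses_epi epi]] := agf.
by move=> T a b eab; apply: epi; rewrite !compmA eab.
Qed.

(** A map [a] with [a \oc u = b \oc p] kills [u \oc i], hence descends along the cokernel [c]. The
    square feeds [Q_pushout] and [A6]; the next lemma is its dual. *)
Lemma ses_quotient_pushout X' X X'' Z W (i : mor X' X) (p : mor X X'')
    (u : mor X Z) (c : mor Z W) (u' : mor X'' W) :
  ses i p -> ses (u \oc i) c -> u' \oc p = c \oc u -> is_pushout u p c u'.
Proof.
move=> E Ec u'p; split=> // T a b aubp.
have aui0 : a \oc (u \oc i) = 0.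
  by rewrite compmA aubp -compmA (ses_comp0 E) compm0.
have [t tc] := ses_factor_cokernel Ec aui0.
exists t; split=> [|t' [t'c _]].
  by split=> //; apply: (ses_epi E); rewrite -compmA u'p compmA tc.
by apply: (ses_epi Ec); rewrite tc t'c.
Qed.

Lemma ses_kernel_pullback Y' Y Y'' Z Z' (j : mor Y' Y) (q : mor Y Y'')
    (v : mor Z Y) (k : mor Z' Z) (v' : mor Z' Y') :
  ses j q -> ses k (q \oc v) -> j \oc v' = v \oc k -> is_pullback k v' v j.
Proof.
move=> E Ek jv'; split=> // T a b vajb.
have qva0 : (q \oc v) \oc a = 0.
  by rewrite -compmA vajb compmA (ses_comp0 E) comp0m.
have [t kt] := ses_factor_kernel Ek qva0.
exists t; split=> [|t' [kt' _]].
  by split=> //; apply: (ses_mono E); rewrite compmA jv' -compmA kt.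
by apply: (ses_mono Ek); rewrite kt kt'.
Qed.

(* The cokernel of [u'] is the kernel of [Coker (k \oc u') -> Y]. *)
Lemma adm_mono_cancel X Z' Z Y (k : mor Z' Z) (w : mor Z Y) (u' : mor X Z') :
  epis_have_kernels -> ses k w -> adm_mono (k \oc u') -> adm_mono u'.
Proof.
move=> hker Ek [D [d Ed]].
have wku0 : w \oc (k \oc u') = 0 by rewrite compmA (ses_comp0 Ek) comp0m.
have [w' w'd] := ses_factor_cokernel Ed wku0.
have [K [m Em]] : adm_epi w'.
  by apply: (adm_epi_cancel (f := d)) => //; rewrite w'd; exists Z', k.
have w'dk0 : w' \oc (d \oc k) = 0 by rewrite compmA w'd (ses_comp0 Ek).
have [d' md'] := ses_factor_kernel Em w'dk0.
(* [d'] is the base change of [d] along [m], because [k] is a kernel of [w = w' \oc d]. *)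
have [N [n En]] : adm_epi d'.
  apply: (Q_pullback (exactP C) (u := k) (q := d) (v := m)).
    by exists X, (k \oc u').
  by apply: ses_kernel_pullback Em _ md'; rewrite w'd.
have d'u0 : d' \oc u' = 0.
  apply: (ses_mono Em).
  by rewrite compm0 compmA md' -compmA (ses_comp0 Ed).
(* [s : X -> N] and [r : N -> X] will be mutually inverse, so [u'] is, like [n], a kernel of
   [d']. *)
have [s ns] := ses_factor_kernel En d'u0.
have dkn0 : d \oc (k \oc n) = 0.
  by rewrite compmA -md' -compmA (ses_comp0 En) compm0.
have [r kur] := ses_factor_kernel Ed dkn0.
have u'r : u' \oc r = n by apply: (ses_mono Ek); rewrite compmA.
exists K, d'.
apply: (Q_iso (exactP C) (a' := r) (a := id_mor Z') (a'' := id_mor K) En).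
- exists s; split.
    by apply: (ses_mono En); rewrite compmA ns u'r compm_idr.
  by apply: (ses_mono Ed); rewrite -!compmA (compmA u') u'r ns compm_idr.
- exact: is_iso_id.
- exact: is_iso_id.
- by rewrite u'r compm_idl.
- by rewrite compm_idl compm_idr.
Qed.

End ExactCategories.

(** * Compatible morphisms and their factorizations *)

Section Compatibility.
Variables (C : exact_category) (A : arith_structure C).
Implicit Types X Y : arith_object A.

Lemma compatible_sub X' X Y (i : mor X' X) (hi : adm_mono i) (f : mor X Y) :
  str X' = pull hi (str X) -> compatible f -> compatible (X := X') (f \oc i).
Proof.
move=> eX' [Z [u [v [hu [hv [-> eX eY]]]]]].
exists Z, (u \oc i), v, (adm_mono_comp hu hi), hv.
split=> //; first by rewrite compmA.
by rewrite eX' eX; apply/esym/A2.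
Qed.

Lemma compatible_quot X Y Y' (p : mor Y Y') (hp : adm_epi p) (f : mor X Y) :
  str Y' = push hp (str Y) -> compatible f -> compatible (Y := Y') (p \oc f).
Proof.
move=> eY' [Z [u [v [hu [hv [-> eX eY]]]]]].
exists Z, u, (p \oc v), hu, (adm_epi_comp hp hv).
split=> //; first by rewrite compmA.
by rewrite eY' eY; apply/esym/A3.
Qed.

Lemma trivial_compatible X Y (f : mor X Y) : trivial_arith A -> compatible f.
Proof.
move=> trivA; have oneA Z (a b : A Z) : a = b.
  by have [c cu] := trivA Z; rewrite (cu a) (cu b).
have [c _] := trivA (biprod (under X) (under Y)).
exists (ArithObject c), (pairm (id_mor _) f), (pr2 _ _).
exists (adm_mono_graph f), (adm_epi_pr2 _ _); split; try exact: oneA.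
by rewrite /pairm compmDr !compmA pr2_in1 pr2_in2 comp0m add0r compm_idl.
Qed.

Hypothesis hA : trivial_arith A \/ epis_have_kernels C.

(** The witness [Z] is replaced by its quotient [W] by [X']: [u'] is a pushout of [u], and [A6]
    matches the structures on [X'']. *)
Lemma compatible_factor_quot X Y (X' X'' : C) (i : mor X' X) (p : mor X X'')
    (hp : adm_epi p) (f : mor X Y) :
  ses i p -> compatible f -> f \oc i = 0 ->
  exists f' : mor X'' Y, f' \oc p = f /\ compatible (X := aquot hp) f'.
Proof.
move=> E cf fi0; case: hA => [trivA|hker].
  have [f' f'p] := ses_factor_cokernel E fi0.
  by exists f'; split=> //; exact: trivial_compatible.
case: cf => [Z [u [v [hu [hv [ef eX eY]]]]]].
have hi : adm_mono i by exists X'', p.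
have [W [c Ec]] := adm_mono_comp hu hi.
have hc : adm_epi c by exists X', (u \oc i).
have cui0 : (c \oc u) \oc i = 0 by rewrite -compmA (ses_comp0 Ec).
have [u' u'p] := ses_factor_cokernel E cui0.
have po := ses_quotient_pushout E Ec u'p.
have hu' : adm_mono u' := Q_pushout (exactP C) hu po.
have vui0 : v \oc (u \oc i) = 0 by rewrite compmA -ef.
have [v' ev] := ses_factor_cokernel Ec vui0.
(* [v] becomes [v' \oc c] also inside the witness [hv] on which [eY] depends. *)
case: _ / ev in hv ef eY vui0.
have hv' : adm_epi v' := adm_epi_cancel hker hv.
exists (v' \oc u'); split; first by rewrite -compmA u'p compmA ef.
exists (ArithObject (push hc (str Z))), u', v', hu', hv'; split=> //=.
  by rewrite eX; apply/esym/A6; right.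
by rewrite eY; exact: A3.
Qed.

(** Dually, [Z] is replaced by the preimage [Z'] of [Y'] under [v]; the admissibility of [u'] is the
    part that needs [adm_mono_cancel]. *)
Lemma compatible_factor_sub X Y (Y' Y'' : C) (j : mor Y' Y) (q : mor Y Y'')
    (hj : adm_mono j) (f : mor X Y) :
  ses j q -> compatible f -> q \oc f = 0 ->
  exists f' : mor X Y', j \oc f' = f /\ compatible (Y := asub hj) f'.
Proof.
move=> E cf qf0; case: hA => [trivA|hker].
  have [f' jf'] := ses_factor_kernel E qf0.
  by exists f'; split=> //; exact: trivial_compatible.
case: cf => [Z [u [v [hu [hv [ef eX eY]]]]]].
have hq : adm_epi q by exists Y', j.
have [Z' [k Ek]] := adm_epi_comp hq hv.
have hk : adm_mono k by exists Y'', (q \oc v).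
have qvk0 : q \oc (v \oc k) = 0 by rewrite compmA (ses_comp0 Ek).
have [v' jv'] := ses_factor_kernel E qvk0.
have pb := ses_kernel_pullback E Ek jv'.
have hv' : adm_epi v' := Q_pullback (exactP C) hv pb.
have qvu0 : (q \oc v) \oc u = 0 by rewrite -compmA -ef.
have [u' eu] := ses_factor_kernel Ek qvu0.
case: _ / eu in hu ef eX qvu0.
have hu' : adm_mono u' := adm_mono_cancel hker Ek hu.
exists (v' \oc u'); split; first by rewrite compmA jv' -compmA ef.
exists (ArithObject (pull hk (str Z))), u', v', hu', hv'; split=> //=.
  by rewrite eX; exact: A2.
by rewrite eY; apply: A6; left.
Qed.

End Compatibility.

(** * Slopes along Harder-Narasimhan sequences and the dévissage *)

Section HNFiltrations.
Variables (R : realType) (C : exact_category) (A : arith_structure C).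
Variables (deg : degree_function R A) (rk : rank_function C).
Implicit Types X Y S : arith_object A.

(** Some [i0 >= i] has slope at least [lam], as otherwise the maximum would be at most [i]; slopes
    decrease along the sequence. *)
Lemma hn_index_slope_ge X (s : HN_sequence deg rk X) (lam : R)
    (i : 'I_(seq_len s)) :
  (i < hn_index s lam)%N -> lam <= slope deg rk (seq_gr i).
Proof.
rewrite /= /hn_index_nat => lti.
have [i0 lam_i0 le_i] : exists2 i0 : 'I_(seq_len s),
    lam <= slope deg rk (seq_gr i0) & (i <= i0)%N.
  apply: contraPP lti => no; apply/negP; rewrite -leqNgt.
  apply/bigmax_leqP => i1 lam_i1; rewrite ltnNge; apply/negP => le_i.
  by apply: no; exists i1.
move: le_i; rewrite leq_eqVlt => /orP[/eqP/val_inj -> //|lt_i].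
exact: le_trans lam_i0 (ltW (hn_decreasing lt_i)).
Qed.

(** With slope at least [lam], [i] would contribute [i.+1] to the maximum, pushing the index past
    [i]. *)
Lemma hn_index_slope_lt X (s : HN_sequence deg rk X) (lam : R)
    (i : 'I_(seq_len s)) :
  (hn_index s lam <= i)%N -> slope deg rk (seq_gr i) < lam.
Proof.
move=> le_i; rewrite ltNge; apply/negP => lam_i; move: le_i.
apply/negP; rewrite -ltnNge.
exact: (leq_bigmax_cond (F := fun i : 'I_(seq_len s) => i.+1) i).
Qed.

Lemma seq_term_map X (s : mono_sequence (under X))
    (i j : 'I_(seq_len s).+1) (ij : (i <= j)%N) :
  str (@seq_term C A X s i) = pull (seq_map_adm ij) (str (@seq_term C A X s j)).
Proof.
(* The admissibility witness is generalized first, since its type mentions the inclusion being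
   rewritten. *)
rewrite /=; move: (seq_incl_adm i); rewrite (seq_incl_map ij) => hi.
exact: A2.
Qed.

Hypothesis hn2 : HN2 deg rk.
Hypothesis hA : trivial_arith A \/ epis_have_kernels C.

Lemma compatible_semistable_eq0 X (s : HN_sequence deg rk X) S
    (i : 'I_(seq_len s).+1) (g : mor (seq_term i) S) :
  semistable deg rk S ->
  (forall i0 : 'I_(seq_len s), (i0 < i)%N ->
     slope deg rk S < slope deg rk (seq_gr i0)) ->
  compatible g -> g = 0.
Proof.
(* The induction runs on the value of [i], as the source of [g] depends on the ordinal itself. *)
move=> ssS; have [k ek] : exists k, (i : nat) = k by exists i.
elim: k i ek g => [|k IHk] i ek g slope_lt cg.
  apply: zero_mor_eq; have -> : i = ord0 by exact: val_inj.
  exact: seq_bot.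
case: (unliftP ord0 i) => [i0|] ei; last by rewrite ei in ek.
rewrite {}ei in ek g slope_lt cg *; rewrite /= /bump add1n in ek.
case: ek => ek.
have ii : (widen_ord (leqnSn (seq_len s)) i0 <= fintype.lift ord0 i0)%N.
  by rewrite /= /bump leq0n add1n.
have g0 : g \oc seq_map s ii = 0.
  apply: (IHk (widen_ord (leqnSn _) i0)) => //.
    by move=> i1 lt1; apply: slope_lt; exact: leq_trans lt1 ii.
  exact: (compatible_sub (X' := seq_term (widen_ord _ i0))
            (X := seq_term (fintype.lift ord0 i0)) (seq_term_map ii) cg).
(* Vanishing on the previous term, [g] descends to a semistable subquotient of slope above that of
   [S], where (HN2) applies. *)
have [g' [<- cg']] :=
  compatible_factor_quot (X := seq_term (fintype.lift ord0 i0)) hA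
    (seq_proj_adm i0) (seq_ses ii) cg g0.
rewrite (_ : g' = 0) ?comp0m //.
apply: (hn2 (X1 := seq_gr i0)) => //; first exact: hn_semistable.
by apply: slope_lt; rewrite /= /bump add1n.
Qed.

Lemma compatible_hn_factor X Y (sX : HN_sequence deg rk X)
    (sY : HN_sequence deg rk Y) (f : mor X Y) (lam : R) :
  compatible f ->
  exists t : mor (seq_obj (hn_index sX lam)) (seq_obj (hn_index sY lam)),
    seq_incl (hn_index sY lam) \oc t = f \oc seq_incl (hn_index sX lam).
Proof.
move=> cf; set a := hn_index sX lam; set b := hn_index sY lam.
(* Descending induction from [Y] to [Y_b], with [d] the distance to the top; compatibility is
   carried along for the next step. *)
suff factor (d : nat) : forall j : 'I_(seq_len sY).+1,
    (j + d = seq_len sY)%N -> (b <= j)%N ->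
    exists t : mor (seq_term a) (seq_term j),
      seq_incl j \oc t = f \oc seq_incl a /\ compatible t.
  have [|//|t [et _]] := factor (seq_len sY - b)%N b.
    by rewrite subnKC // leq_ord.
  by exists t.
have cfa : compatible (X := seq_term a) (f \oc seq_incl a).
  exact: (compatible_sub (X' := seq_term a) (hi := seq_incl_adm a) erefl cf).
elim: d => [|d IHd] j ej bj.
  have -> : j = ord_max by apply: val_inj; rewrite -[LHS]addn0.
  (* The top term is only isomorphic to [Y], so this case too is a factorization through a
     subobject, with cokernel map [q = 0]. *)
  have [Q [q Eq]] := seq_incl_adm (ord_max : 'I_(seq_len sY).+1).
  apply: (compatible_factor_sub hA _ Eq cfa).
  have [t [_ topt]] := seq_top_iso sY.
  have -> : q = 0; last exact: comp0m.
  have := ses_comp0 Eq; rewrite /seq_incl seq_map_id compm_idr => qtop0.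
  by rewrite -[q]compm_idr -topt compmA qtop0 comp0m.
have ltj : (j < seq_len sY)%N.
  by apply: leq_trans (eq_leq ej); rewrite addnS ltnS leq_addr.
pose j0 := Ordinal ltj.
have ew : widen_ord (leqnSn (seq_len sY)) j0 = j by exact: val_inj.
rewrite -ew; rewrite -{}ew /= in ej bj.
have [| |t [et ct]] := IHd (fintype.lift ord0 j0).
- by rewrite /= /bump add1n addSnnS.
- by rewrite /= /bump add1n; exact: leq_trans bj (leqnSn _).
have jj : (widen_ord (leqnSn (seq_len sY)) j0 <= fintype.lift ord0 j0)%N.
  by rewrite /= /bump leq0n add1n.
(* Subquotients of [X] below [a] have slope at least [lam], while [j0 >= b] gives [seq_gr j0] slope
   below [lam]. *)
have qt0 : seq_proj sY j0 \oc t = 0.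
  apply: (compatible_semistable_eq0 (S := seq_gr j0)).
  - exact: hn_semistable.
  - move=> i0 /hn_index_slope_ge; apply: lt_le_trans.
    exact: hn_index_slope_lt.
  - exact: (compatible_quot (Y := seq_term (fintype.lift ord0 j0))
             (Y' := seq_gr j0) (hp := seq_proj_adm j0) erefl ct).
have [t' [et' [Z [u [v [hu [hv [ev eX eY]]]]]]]] :=
  compatible_factor_sub (Y := seq_term (fintype.lift ord0 j0)) hA
    (seq_map_adm jj) (seq_ses jj) ct qt0.
exists t'; split; first by rewrite (seq_incl_map jj) -compmA et' et.
(* The structure induced through the next term of [sY] equals the one induced from [Y]. *)
by exists Z, u, v, hu, hv; split=> //; rewrite (seq_term_map jj).
Qed.

End HNFiltrations.

Theorem theorem5p3 (R : realType) (C : exact_category) (A : arith_structure C)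
  (deg : degree_function R A) (rk : rank_function C)
  (hHN : HN_category deg rk)
  (hker : ~ trivial_arith A ->
    forall (X Y : C) (f : mor X Y), is_epi f ->
    exists (K : C) (k : mor K X), is_kernel k f)
  (X Y : arith_object A) (f : mor (under X) (under Y)) (hf : compatible f)
  (sX : HN_sequence deg rk X) (sY : HN_sequence deg rk Y) :
  filtration_compatible (HN_filtration sX) (HN_filtration sY) f.
Proof.
have hA : trivial_arith A \/ epis_have_kernels C.
  by have [|/hker] := EM (trivial_arith A); [left | right].
pose F := HN_filtration sX; pose G := HN_filtration sY.
pose factor lam := cid (compatible_hn_factor hHN.2 hA sX sY lam hf).
pose eta (a : Rstar R) : mor (F a) (G a) :=
  match a return mor (hn_fobj sX a) (hn_fobj sY a) with
  | None => f
  | Some lam => projT1 (factor lam)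
  end.
have eta_incl (a : Rstar R) (an : mor a (None : Rstar R)) :
    functor_map G an \oc eta a = f \oc functor_map F an.
  case: a an => [lam|] an /=; last by rewrite compm_idl compm_idr.
  exact: projT2 (factor lam).
(* The components are arbitrary choices; naturality holds since, after the monomorphism into [Y],
   both sides become [f] composed with the map from [F a] to [X]. *)
suff nat_eta (a b : Rstar R) (ab : mor a b) :
    eta b \oc functor_map F ab = functor_map G ab \oc eta a.
  by exists (NatTrans nat_eta).
pose bn : mor b (None : Rstar R) := isT.
apply: (fil_mono (i := b) (j := None) (f := G) (ij := bn)).
by rewrite !compmA eta_incl -functor_map_comp eta_incl -compmA functor_map_comp.
Qed.
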